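(* There is an assignment $x\mapsto G_x$ which associates to any $x\in\mathbb{R}^{\mathbb{N}}$ a separable metrizable group $G_x$ with the strong Lévy property such that for any $x,y\in\mathbb{R}^{\mathbb{N}}$, we have $x=^+y$ if and only if $G_x$ and $G_y$ are isomorphic as topological groups.
   Context: For $x=(x_n)_n,y=(y_n)_n\in\mathbb{R}^{\mathbb{N}}$, $x=^+y$ means $\{x_n : n\in\mathbb{N}\}=\{y_n : n\in\mathbb{N}\}$ (equality as sets). A topological group $G$ has the strong Lévy property if there is an increasing sequence $(K_i)_{i\in\mathbb{N}}$ of finite subgroups of $G$, with normalized counting measures $\mu_i$ on $K_i$ (regarded as measures on $G$), such that (i) $\bigcup_i K_i$ is dense in $G$, and (ii) for each open neighborhood $V$ of the identity of $G$ and each sequence of sets $A_i\subseteq K_i$ with $\liminf_i\mu_i(A_i)>0$, one has $\lim_i\mu_i(VA_i)=1$. All topological groups are assumed Hausdorff. *)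

(* Defs.v *)
From HB Require Import structures.
From mathcomp Require Import all_boot all_order all_algebra finmap.
From mathcomp Require Import all_classical all_reals all_analysis.

Set Implicit Arguments.
Unset Strict Implicit.
Unset Printing Implicit Defensive.
Import numFieldNormedType.Exports.

Local Open Scope classical_set_scope.
Local Open Scope ring_scope.

(* Topological groups are Hausdorff by convention. *)
HB.mixin Record isTopologicalGroup G & Topological G & Group G := {
  mulg_continuous : continuous (fun z : G * G => z.1 * z.2)%g;
  invg_continuous : continuous (fun z : G => z^-1)%g;
  topgroup_hausdorff : hausdorff_space G
}.

#[short(type="topologicalGroupType")]
HB.structure Definition TopologicalGroup :=
  {G of Topological G & Group G & isTopologicalGroup G}.

Definition homeomorphism (X Y : topologicalType) (f : X -> Y) : Prop :=
  continuous f /\ exists g : Y -> X, [/\ cancel f g, cancel g f & continuous g].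

Definition topgroup_isomorphic (G H : topologicalGroupType) : Prop :=
  exists f : {multiplicative G -> H}, homeomorphism f.

Definition separable (X : topologicalType) : Prop :=
  exists D : set X, countable D /\ dense D.

Definition metrizable (R : realType) (X : topologicalType) : Prop :=
  exists (M : metricType R) (f : X -> M), homeomorphism f.

(* The normalized counting measure on K, as a measure on all subsets of T. *)
Definition counting_prob (R : realType) (T : choiceType) (K : {fset T})
    (A : set T) : R :=
  #|` [fset x in K | x \in A]%fset |%:R / #|` K |%:R.

Definition strong_levy (R : realType) (G : topologicalGroupType) : Prop :=
  exists K : nat -> {fset G},
    [/\ forall i, group_closed (mem (K i)),
        forall i, (K i `<=` K i.+1)%fset,
        dense (\bigcup_i [set` K i]) &
        forall (V : set G) (A : nat -> set G),
          open_nbhs 1%g V ->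
          (forall i, A i `<=` [set` K i]) ->
          0 < limn_inf (fun i => counting_prob R (K i) (A i)) ->
          counting_prob R (K i) [set (v * a)%g | v in V & a in A i]
            @[i --> \oo] --> (1 : R)].

(* The equivalence relation written x =^+ y. *)
Definition eq_plus (R : realType) (x y : nat -> R) : Prop :=
  range x = range y.

(* Main.v *)
From HB Require Import structures.
Require Import Defs.
From mathcomp Require Import all_boot all_order all_algebra.
From mathcomp Require Import finmap.
From mathcomp Require Import all_classical all_reals all_analysis.
From mathcomp Require Import ring.

(** The theorem asks for a strong Levy group attached to each countable set
    of reals, pairwise non-isomorphic; isomorphism is already obstructed
    algebraically, by torsion.

    Fix an abelian group [W] with an increasing sequence of finite subgroups
    [F i]. A function [nat -> W] that has period [2 ^ i] and values in [F i]
    for some [i] is a dyadic step function; these functions form a countable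
    abelian group, and the density of the set where two of them differ is an
    invariant metric ([stepFun], [len]). It is the union of the finite
    subgroups [level_group i], each of which is a power of [F i] with
    [2 ^ i] factors under the normalized Hamming distance.

    The strong Levy property is concentration of measure in these Hamming
    cubes ([level_group_ratio]), which has a second-moment proof. Let [f] be
    the distance to a set [A] in a cube with [N] factors; it changes by at
    most [1 / N] along each coordinate. Averaging [f] over one coordinate
    after another ends in a constant [m], the mean of [f], and each averaging
    lowers the mean square by at most [1 / N ^ 2] ([energy_drop]); so the
    variance of [f] is at most [1 / N]. As [f] vanishes on [A], [m] is of
    order [1 / sqrt N] when [A] keeps a positive proportion, and by Markov's
    inequality the points at distance [e] from [A] have proportion of order
    [1 / (e * sqrt N)] ([far_set_small]). The argument takes place inside the
    ambient abelian group, on which the coordinate subgroups act by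
    translation.

    For a set [S] of naturals take as [W] the product of the prime fields of
    order [p_n], and as [F i] the families supported on the [n < i] in [S].
    The group of step functions then has an element of order [p_n] exactly
    when [n] is in [S] ([supp_torsion]), so its isomorphism class determines
    [S]. It remains to code a nonempty countable set of reals, injectively,
    by a set of naturals: choose an enumeration that depends on the set only
    and record the Dedekind cuts of its terms ([code_inj]). *)

Set Implicit Arguments.
Unset Strict Implicit.
Unset Printing Implicit Defensive.
Import Order.TTheory GRing.Theory Num.Theory.
Import numFieldNormedType.Exports.

Local Open Scope classical_set_scope.
Local Open Scope ring_scope.

(** * Variance and concentration in finite abelian groups *)

Section Concentration.
Variables (R : realFieldType) (G : groupType).
Hypothesis mulgC : forall x y : G, (x * y = y * x)%g.
Implicit Types (K C D A B : {fset G}) (f g : G -> R) (a e : R).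

Definition avg C f (x : G) : R := (\sum_(c <- C) f (x * c)%g) / #|` C|%:R.

Definition step_le a C f := forall x c, c \in C -> `|f (x * c)%g - f x| <= a.

Definition invariant_under C f := forall x c, c \in C -> f (x * c)%g = f x.

Lemma card_group_gt0 C : group_closed (mem C) -> 0 < #|` C|%:R :> R.
Proof. by move=> [C1 _]; rewrite ltr0n cardfs_gt0; apply/fset0Pn; exists 1%g. Qed.

Lemma sum_fset_cst (C : {fset G}) a : \sum_(x <- C) a = #|` C|%:R * a.
Proof. by rewrite big_const_seq count_predT iter_addr_0 mulr_natl. Qed.

Lemma sum_translate K f c : group_closed (mem K) -> c \in K ->
  \sum_(x <- K) f (x * c)%g = \sum_(x <- K) f x.
Proof.
move=> gK cK; rewrite -(big_map (fun x => x * c)%g xpredT f).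
apply: perm_big; apply: uniq_perm => [||x].
- by rewrite map_inj_uniq ?fset_uniq//; apply: mulIg.
- exact: fset_uniq.
have KM := group_closedM gK; have KV := group_closedV gK.
apply/mapP/idP => [[y yK ->]|xK]; first exact: KM.
by exists (x / c)%g; [apply: KM => //; apply: KV | rewrite divgK].
Qed.

Lemma sum_avg K C f : group_closed (mem K) -> group_closed (mem C) ->
  (C `<=` K)%fset -> \sum_(x <- K) avg C f x = \sum_(x <- K) f x.
Proof.
move=> gK gC /fsubsetP CK; have C0 := card_group_gt0 gC.
rewrite -mulr_suml exchange_big/=.
rewrite (eq_big_seq (fun=> \sum_(x <- K) f x)); last first.
  by move=> c /CK; apply: sum_translate.
by rewrite sum_fset_cst mulrC mulKf ?gt_eqF.
Qed.

Lemma avg_invariant C f : group_closed (mem C) -> invariant_under C (avg C f).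
Proof.
move=> gC x c cC; rewrite /avg; congr (_ / _).
rewrite -(sum_translate (fun d => f (x * d)%g) gC cC).
by apply: eq_bigr => d _; rewrite (mulgC d) mulgA.
Qed.

(** Since the group is abelian, averaging over a second subgroup does not
    destroy the invariance gained by averaging over a first one. *)
Lemma avg_preserves_invariant C D f :
  invariant_under D f -> invariant_under D (avg C f).
Proof.
move=> fD x d dD; rewrite /avg; congr (_ / _); apply: eq_bigr => c _.
by rewrite -mulgA (mulgC d) mulgA fD.
Qed.

Lemma avg_cst C a : group_closed (mem C) -> (\sum_(c <- C) a) / #|` C|%:R = a.
Proof.
move=> /card_group_gt0 C0.
by rewrite sum_fset_cst mulrC mulKf ?gt_eqF.
Qed.

Lemma avg_norm_le C a (h : G -> R) : group_closed (mem C) ->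
  (forall c, c \in C -> `|h c| <= a) -> `|(\sum_(c <- C) h c) / #|` C|%:R| <= a.
Proof.
move=> gC ha; rewrite -[leRHS](avg_cst a gC) normrM normfV normr_nat.
rewrite ler_wpM2r ?invr_ge0 ?ler0n//; apply: le_trans (ler_norm_sum _ _ _) _.
by rewrite big_seq [leRHS]big_seq; apply: ler_sum.
Qed.

Lemma avg_step_le C D a f : group_closed (mem C) ->
  step_le a D f -> step_le a D (avg C f).
Proof.
move=> gC fD x d dD; rewrite /avg -mulrBl -sumrB; apply: avg_norm_le => // c _.
by rewrite -mulgA (mulgC d) mulgA; apply: fD.
Qed.

Lemma avg_dist_le C a f : group_closed (mem C) ->
  step_le a C f -> forall x, `|avg C f x - f x| <= a.
Proof.
move=> gC fC x; rewrite -[X in _ - X](avg_cst _ gC) /avg -mulrBl -sumrB.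
by apply: avg_norm_le => // c; apply: fC.
Qed.

(** The average [p] of [f] over [C] is the orthogonal projection of [f] on
    the [C]-invariant functions, so by Pythagoras the loss is the sum of the
    squares of [p - f], each at most [a ^+ 2]. *)
Lemma energy_drop K C a f : group_closed (mem K) -> group_closed (mem C) ->
  (C `<=` K)%fset -> step_le a C f ->
  \sum_(x <- K) f x ^+ 2 <=
    \sum_(x <- K) avg C f x ^+ 2 + #|` K|%:R * a ^+ 2.
Proof.
move=> gK gC CK fC; set p := avg C f.
(* Orthogonality: [p] is [C]-invariant, so averaging [f * p] gives [p * p]. *)
have orth : \sum_(x <- K) f x * p x = \sum_(x <- K) p x ^+ 2.
  rewrite -(sum_avg _ gK gC CK); apply: eq_bigr => x _.
  rewrite {1}/avg expr2 [in RHS]/p {1}/avg mulrAC; congr (_ / _).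
  by rewrite mulr_suml; apply: eq_big_seq => c cC; rewrite /p avg_invariant.
have -> : \sum_(x <- K) f x ^+ 2 =
    \sum_(x <- K) p x ^+ 2 + \sum_(x <- K) (p x - f x) ^+ 2.
  rewrite -big_split/=.
  transitivity (\sum_(x <- K) (f x ^+ 2 + 2 * (p x ^+ 2 - f x * p x))).
    by rewrite big_split/= -mulr_sumr sumrB orth subrr mulr0 addr0.
  by apply: eq_bigr => x _; ring.
rewrite lerD2l -sum_fset_cst; apply: ler_sum => x _.
by rewrite -real_normK ?num_real// lerXn2r ?nnegrE//;
   [apply: le_trans (avg_dist_le gC fC x)| apply: avg_dist_le].
Qed.

Section Chain.
Variables (K : {fset G}) (C : nat -> {fset G}) (a : R).
Hypotheses (gK : group_closed (mem K)) (gC : forall j, group_closed (mem (C j))).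
Hypothesis CK : forall j, (C j `<=` K)%fset.

Fixpoint avgs N f := if N is n.+1 then avg (C n) (avgs n f) else f.

Lemma avgs_step_le N f j : step_le a (C j) f -> step_le a (C j) (avgs N f).
Proof. by move=> fC; elim: N => //= n IH; apply: avg_step_le. Qed.

Lemma sum_avgs N f : \sum_(x <- K) avgs N f x = \sum_(x <- K) f x.
Proof. by elim: N => //= n IH; rewrite sum_avg. Qed.

Lemma avgs_invariant N f j : (j < N)%N -> invariant_under (C j) (avgs N f).
Proof.
elim: N => //= n IH; rewrite ltnS leq_eqVlt => /predU1P[->|jn].
  exact: avg_invariant.
by apply: avg_preserves_invariant; apply: IH.
Qed.

Lemma energy_drops N f : (forall j, step_le a (C j) f) ->
  \sum_(x <- K) f x ^+ 2 <=
    \sum_(x <- K) avgs N f x ^+ 2 + #|` K|%:R * a ^+ 2 *+ N.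
Proof.
move=> fC; elim: N => [|n IH]/=; first by rewrite mulr0n addr0.
apply: le_trans IH _; rewrite mulrS addrA lerD2r.
by apply: energy_drop => //; apply: avgs_step_le.
Qed.

Variable N : nat.
Hypothesis K_gen : forall x, x \in K ->
  exists2 c : nat -> G, forall j, c j \in C j & x = (\prod_(j < N) c j)%g.

(** After averaging over every [C j] the function is invariant under all of
    them, hence under the group that they generate. *)
Lemma avgs_cst f x : x \in K -> avgs N f x = avgs N f 1%g.
Proof.
move=> /K_gen[c cC ->].
have: forall n, (n <= N)%N -> avgs N f (\prod_(j < n) c j)%g = avgs N f 1%g.
  elim=> [|n IH] nN; first by rewrite big_ord0.
  by rewrite big_ord_recr/= (avgs_invariant _ nN)// IH// ltnW.
exact.
Qed.

(** The variance of [f] on [K] is at most [a ^+ 2 *+ N]. Restricted to [A],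
    where [f] is [0], the variance bounds the square of the mean [m] from
    above; Markov's inequality on [B] bounds [m] from below. Eliminating [m]
    gives the estimate. *)
Lemma vanishing_set_deviation A B e f : (A `<=` K)%fset -> (B `<=` K)%fset ->
  (forall j, step_le a (C j) f) -> (forall x, 0 <= f x) -> 0 <= e ->
  (forall x, x \in A -> f x = 0) -> (forall x, x \in B -> e <= f x) ->
  #|` A|%:R * (#|` B|%:R * e) ^+ 2 <= #|` K|%:R ^+ 3 * (a ^+ 2 *+ N).
Proof.
move=> AK BK fC f0 e0 fA fB; set m := avgs N f 1%g; set k : R := #|` K|%:R.
have k0 : 0 < k by apply: card_group_gt0.
have sumf : \sum_(x <- K) f x = k * m.
  by rewrite -(sum_avgs N) -sum_fset_cst; apply: eq_big_seq => x /avgs_cst.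
have sumf2 : \sum_(x <- K) f x ^+ 2 <= k * m ^+ 2 + k * (a ^+ 2 *+ N).
  apply: le_trans (energy_drops N fC) _.
  rewrite (eq_big_seq (fun=> m ^+ 2)) ?sum_fset_cst; last by move=> x /avgs_cst ->.
  by rewrite mulrnAr.
have var : \sum_(x <- K) (f x - m) ^+ 2 <= k * (a ^+ 2 *+ N).
  have -> : \sum_(x <- K) (f x - m) ^+ 2 = \sum_(x <- K) f x ^+ 2 - k * m ^+ 2.
    transitivity (\sum_(x <- K) (f x ^+ 2 + (m ^+ 2 - 2 * m * f x))).
      by apply: eq_bigr => x _; ring.
    rewrite big_split/= sumrB sum_fset_cst -mulr_sumr sumf -/k; ring.
  by rewrite lerBlDl.
have sub_sum (D : {fset G}) (h : G -> R) : (forall x, 0 <= h x) ->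
    (D `<=` K)%fset -> \sum_(x <- D) h x <= \sum_(x <- K) h x.
  move=> h0 /fsubsetP DK.
  have -> : D = [fset x in K | x \in D]%fset.
    by apply/fsetP => x; rewrite !inE/= andb_idl//; apply: DK.
  by rewrite -big_fset_condE big_mkcond; apply: ler_sum => x _; case: ifP.
have Am : #|` A|%:R * m ^+ 2 <= k * (a ^+ 2 *+ N).
  apply: le_trans var; apply: le_trans (sub_sum _ _ _ AK); last first.
    by move=> x; rewrite sqr_ge0.
  rewrite -sum_fset_cst big_seq [leRHS]big_seq; apply: ler_sum => x /fA ->.
  by rewrite sub0r sqrrN.
have Be : #|` B|%:R * e <= k * m.
  rewrite -sumf; apply: le_trans (sub_sum _ _ f0 BK).
  by rewrite -sum_fset_cst big_seq [leRHS]big_seq; apply: ler_sum => x /fB.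
have Be2 : (#|` B|%:R * e) ^+ 2 <= (k * m) ^+ 2.
  apply: lerXn2r => //; rewrite nnegrE; first by rewrite mulr_ge0 ?ler0n.
  by rewrite -sumf sumr_ge0.
apply: le_trans (ler_wpM2l (ler0n _ _) Be2) _.
rewrite exprMn mulrCA [k ^+ 3]exprSr -[leRHS]mulrA; apply: ler_wpM2l => //.
by rewrite exprn_ge0 ?ltW.
Qed.

End Chain.

Section Length.
Variable len : G -> R.
Hypotheses (len_ge0 : forall x, 0 <= len x) (len1 : len 1%g = 0).
Hypothesis lenM : forall x y, len (x * y)%g <= len x + len y.

(** The default value [1] of the minimum makes this the distance truncated at
    [1], which is meaningful for an empty [A] as well. *)
Definition dist_to A (x : G) : R := \big[Num.min/1]_(t <- A) len (x / t)%g.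

Lemma dist_to_ge0 A x : 0 <= dist_to A x.
Proof. by apply: le_bigmin => // t _; apply: len_ge0. Qed.

Lemma dist_to_id A x : x \in A -> dist_to A x = 0.
Proof.
move=> xA; apply/eqP; rewrite eq_le dist_to_ge0 andbT -len1 -(divgg x).
exact: ge_bigmin_seq xA _.
Qed.

Lemma dist_toM A x c : dist_to A (x * c)%g <= dist_to A x + len c.
Proof.
rewrite -lerBlDr /dist_to [leRHS]big_seq; apply: le_bigmin => [|t tA].
  by rewrite lerBlDr (le_trans (bigmin_le_id _ _ _ _))// lerDl.
rewrite lerBlDr; apply: le_trans (lenM _ _).
by rewrite [X in _ <= len X]mulgC mulgA (mulgC c); apply: ge_bigmin_seq tA _.
Qed.

Lemma dist_to_step_le A C a : group_closed (mem C) ->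
  (forall c, c \in C -> len c <= a) -> step_le a C (dist_to A).
Proof.
move=> /group_closedV CV Ca x c cC.
rewrite ler_distl lerBlDr; apply/andP; split; last first.
  by apply: le_trans (dist_toM _ _ _) _; rewrite lerD2l Ca.
rewrite -{1}(mulgK c x); apply: le_trans (dist_toM _ _ _) _.
by rewrite lerD2l Ca//; apply: CV.
Qed.

(** Concentration for a finite group generated by [N] subgroups of diameter
    at most [a]: of two sets at distance [e], one is small as soon as
    [a ^+ 2 *+ N] is small compared with [e ^+ 2]. *)
Lemma far_set_small (K : {fset G}) (C : nat -> {fset G}) (N : nat) a e A B :
  group_closed (mem K) -> (forall j, group_closed (mem (C j))) ->
  (forall j, (C j `<=` K)%fset) ->
  (forall x, x \in K ->
     exists2 c : nat -> G, forall j, c j \in C j & x = (\prod_(j < N) c j)%g) ->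
  (forall j c, c \in C j -> len c <= a) ->
  (A `<=` K)%fset -> (B `<=` K)%fset -> 0 <= e <= 1 ->
  (forall x t, x \in B -> t \in A -> e <= len (x / t)%g) ->
  #|` A|%:R * (#|` B|%:R * e) ^+ 2 <= #|` K|%:R ^+ 3 * (a ^+ 2 *+ N).
Proof.
move=> gK gC CK K_gen Ca AK BK /andP[e0 e1] far.
apply: (@vanishing_set_deviation _ C _ gK gC CK _ K_gen _ _ _ (dist_to A)) => //.
- by move=> j; apply: dist_to_step_le => // c; apply: Ca.
- exact: dist_to_ge0.
- exact: dist_to_id.
by move=> x xB; rewrite /dist_to big_seq; apply: le_bigmin => // t; apply: far.
Qed.

End Length.
End Concentration.

(** * The group of dyadic step functions *)

(** The finite subgroups bound the values of the step functions of a given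
    level, so that each level is a finite group. *)
Record filtration (W : zmodType) := Filtration {
  stage :> nat -> {fset W};
  stage_zmod : forall i, GRing.zmod_closed (mem (stage i));
  stage_sub : forall i, (stage i `<=` stage i.+1)%fset }.

Section Level.
Variables (W : zmodType) (F : filtration W).
Implicit Types (f g : nat -> W) (i j : nat).

Definition level i f :=
  (forall k, f (k + 2 ^ i)%N = f k) /\ (forall k, f k \in F i).

Lemma level_cst0 : level 0 (fun=> 0).
Proof. by split=> // k; have [] := stage_zmod F 0. Qed.

Lemma levelB i f g : level i f -> level i g -> level i (f \- g).
Proof.
move=> [pf vf] [pg vg]; split=> k /=; first by rewrite pf pg.
by have [_] := stage_zmod F i; apply.
Qed.

Lemma levelS i f : level i f -> level i.+1 f.
Proof.
move=> [pf vf]; split=> k; first by rewrite expnS mul2n -addnn addnA !pf.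
exact: (fsubsetP (stage_sub F i)).
Qed.

Lemma level_le i j f : (i <= j)%N -> level i f -> level j f.
Proof.
by move=> /subnK <-; elim: (j - i)%N => // n IH /IH; apply: levelS.
Qed.

Lemma level_mod i f k : level i f -> f (k %% 2 ^ i)%N = f k.
Proof.
move=> [pf _]; rewrite {2}(divn_eq k (2 ^ i)) addnC.
elim: (k %/ 2 ^ i)%N => [|n IH]; first by rewrite mul0n addn0.
by rewrite mulSn addnCA addnC pf.
Qed.

Definition nonzeros i f : nat := (\sum_(k < 2 ^ i) (f k != 0%R))%N.

Lemma nonzerosS i f : level i f -> nonzeros i.+1 f = (2 * nonzeros i f)%N.
Proof.
move=> [pf _]; rewrite /nonzeros -!(big_mkord xpredT (fun k => f k != 0 : nat)).
rewrite expnS mul2n -addnn (big_cat_nat (n := 2 ^ i))//= ?leq_addr//.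
rewrite -{2}[(2 ^ i)%N]add0n big_addn addnK mul2n -addnn; congr (_ + _)%N.
by apply: eq_bigr => k _; rewrite pf.
Qed.

Variable R : realType.

Definition density i f : R := (nonzeros i f)%:R / (2 ^ i)%:R.

Lemma density_le i j f : (i <= j)%N -> level i f -> density j f = density i f.
Proof.
move=> ij fi; have := ij; rewrite -(subnK ij) => _.
elim: (j - i)%N => // n <-; rewrite addSn /density nonzerosS; last first.
  by apply: level_le fi; rewrite leq_addl.
by rewrite expnS !natrM -mulf_div divff ?mul1r// pnatr_eq0.
Qed.

(** Over a longer period the zeros and nonzeros of a periodic function repeat
    proportionally; hence its density may be computed at any of its levels. *)
Lemma density_level i j f : level i f -> level j f -> density i f = density j f.
Proof.
by have [ij|/ltnW ji] := leqP i j => fi fj; [rewrite (density_le ij)|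
  rewrite (density_le ji)].
Qed.

Lemma density_ge0 i f : 0 <= density i f.
Proof. by rewrite divr_ge0 ?ler0n. Qed.

End Level.

(** The parameter [R] makes the type determine the field in which the metric
    takes its values. *)
Definition stepFun (R : realType) (W : zmodType) (F : filtration W) : Type :=
  {f : nat -> W | `[< exists i, level F i f >]}.

Section StepFun.
Variables (R : realType) (W : zmodType) (F : filtration W).
Local Notation G := (stepFun R F).

HB.instance Definition _ := Choice.on G.

Implicit Types x y z : G.

Lemma levelP x : exists i, level F i (sval x).
Proof. by have /asboolP := svalP x. Qed.

Lemma common_level x y : exists i, level F i (sval x) /\ level F i (sval y).
Proof.
have [i xi] := levelP x; have [j yj] := levelP y; exists (i + j)%N; split.
  by apply: level_le xi; rewrite leq_addr.
by apply: level_le yj; rewrite leq_addl.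
Qed.

Definition mkStep i f (fi : level F i f) : G := exist _ f (asboolT (ex_intro _ i fi)).

Lemma stepFun_ext x y : (forall k, sval x k = sval y k) -> x = y.
Proof. by move=> /funext xy; apply: val_inj. Qed.

Lemma sub_step x y : `[< exists i, level F i (sval x \- sval y) >].
Proof.
by apply/asboolP; have [i [xi yi]] := common_level x y; exists i; apply: levelB.
Qed.

Definition step0 : G := mkStep (level_cst0 F).
Definition stepB x y : G := exist _ (sval x \- sval y) (sub_step x y).
Definition stepN x : G := stepB step0 x.
Definition stepD x y : G := stepB x (stepN y).

Lemma stepDE x y k : sval (stepD x y) k = sval x k + sval y k.
Proof. by rewrite /= sub0r opprK. Qed.

Lemma stepNE x k : sval (stepN x) k = - sval x k.
Proof. by rewrite /= sub0r. Qed.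

Lemma stepDA : associative stepD.
Proof. by move=> x y z; apply: stepFun_ext => k; rewrite !stepDE addrA. Qed.
Lemma stepD0l : left_id step0 stepD.
Proof. by move=> x; apply: stepFun_ext => k; rewrite !stepDE add0r. Qed.
Lemma stepD0r : right_id step0 stepD.
Proof. by move=> x; apply: stepFun_ext => k; rewrite !stepDE addr0. Qed.
Lemma stepNl : left_inverse step0 stepN stepD.
Proof. by move=> x; apply: stepFun_ext => k; rewrite stepDE stepNE addNr. Qed.
Lemma stepNr : right_inverse step0 stepN stepD.
Proof. by move=> x; apply: stepFun_ext => k; rewrite stepDE stepNE subrr. Qed.

HB.instance Definition _ := isGroup.Build G stepDA stepD0l stepD0r stepNl stepNr.

Lemma sval_mul x y k : sval (x * y)%g k = sval x k + sval y k.
Proof. exact: stepDE. Qed.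
Lemma sval_inv x k : sval x^-1%g k = - sval x k.
Proof. exact: stepNE. Qed.

Lemma level1 i : level F i (sval (1%g : G)).
Proof. by apply: level_le (level_cst0 F). Qed.

Lemma levelV i x : level F i (sval x) -> level F i (sval x^-1%g).
Proof. by move=> xi; apply: levelB => //; apply: (level1 i). Qed.

Lemma levelM i x y :
  level F i (sval x) -> level F i (sval y) -> level F i (sval (x * y)%g).
Proof. by move=> xi yi; apply: levelB => //; apply: levelV. Qed.

Lemma stepFun_mulC x y : (x * y = y * x)%g.
Proof. by apply: stepFun_ext => k; rewrite !sval_mul addrC. Qed.

Lemma sval_exp x n k : sval (x ^+ n)%g k = sval x k *+ n.
Proof.
by elim: n => [|n IH]; rewrite ?expg0// expgS sval_mul IH mulrS.
Qed.

Lemma sval_prod (I : Type) (r : seq I) (c : I -> G) k :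
  sval (\prod_(j <- r) c j)%g k = \sum_(j <- r) sval (c j) k.
Proof.
exact: (big_morph (fun x : G => sval x k) (fun x y => sval_mul x y k)).
Qed.

(** The normalized Hamming length: the density of the set of nonzero values. *)
Definition len x : R := density R (projT1 (cid (levelP x))) (sval x).

Lemma lenE i x : level F i (sval x) -> len x = density R i (sval x).
Proof. by rewrite /len; case: cid => j /= xj xi; exact: (density_level R xj xi). Qed.

Lemma len_ge0 x : 0 <= len x.
Proof. exact: density_ge0. Qed.

Lemma len1 : len 1%g = 0.
Proof.
rewrite (lenE (level1 0)) /density /nonzeros big1 ?mul0r// => k _.
by rewrite eqxx.
Qed.

Lemma len_eq0 x : len x = 0 -> x = 1%g.
Proof.
have [i xi] := levelP x; rewrite (lenE xi) => /eqP.
rewrite mulf_eq0 invr_eq0 !pnatr_eq0 expn_eq0 /= orbF sum_nat_eq0.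
move=> /forallP x0; apply: stepFun_ext => k; rewrite -(level_mod _ xi).
have := x0 (Ordinal (ltn_pmod k (expn_gt0 2 i))).
by rewrite implyTb/= eqb0 negbK => /eqP.
Qed.

Lemma lenM x y : len (x * y)%g <= len x + len y.
Proof.
have [i [xi yi]] := common_level x y.
rewrite (lenE xi) (lenE yi) (lenE (levelM xi yi)) /density -mulrDl -natrD.
rewrite ler_wpM2r ?invr_ge0 ?ler0n// ler_nat -big_split.
apply: leq_sum => k _; rewrite (sval_mul x y k).
have [->|] := eqVneq (sval x k) 0; first by rewrite add0r.
by move=> _; apply: leq_trans (leq_b1 _) (leq_addr _ _).
Qed.

Lemma lenV x : len x^-1%g = len x.
Proof.
have [i xi] := levelP x.
rewrite (lenE xi) (lenE (levelV xi)); congr (_%:R / _); apply: eq_bigr => k _.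
by rewrite sval_inv oppr_eq0.
Qed.

Definition step_dist x y : R := len (y / x)%g.

Lemma step_distxx x : step_dist x x = 0.
Proof. by rewrite /step_dist divgg len1. Qed.
Lemma step_dist_pos x y : step_dist x y = 0 -> x = y.
Proof. by move=> /len_eq0 /divg1_eq. Qed.
Lemma step_dist_sym x y : step_dist x y = step_dist y x.
Proof. by rewrite /step_dist -lenV invgF. Qed.
Lemma step_dist_tri y x z : step_dist x z <= step_dist x y + step_dist y z.
Proof.
rewrite /step_dist addrC; apply: le_trans (lenM _ _).
by rewrite mulgA divgK.
Qed.

HB.instance Definition _ := @isMetric.Build R G step_dist step_distxx
  step_dist_pos step_dist_sym step_dist_tri.

Lemma stepFun_metrizable : metrizable R G.
Proof.
exists G, idfun; split; first by move=> x; exact: cvg_id.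
by exists idfun; split => // x; exact: cvg_id.
Qed.

Lemma ball_stepFun x (e : R) : ball x e = [set y : G | len (y / x)%g < e].
Proof. exact: ballEmdist. Qed.

Lemma stepFun_mul_continuous : continuous (fun z : G * G => z.1 * z.2)%g.
Proof.
move=> [x y]; apply/(@metricType_numDomainType.cvgrPdist_lt R G) => e e0.
exists (ball x (e / 2), ball y (e / 2)).
  by split; apply: nbhsx_ballx; rewrite divr_gt0.
move=> [x' y'] [/= ]; rewrite !ball_stepFun/= => hx hy.
rewrite /mdist/= /step_dist (_ : _ / _ = (x' / x) * (y' / y))%g.
  by rewrite (le_lt_trans (lenM _ _))// [e]splitr ltrD.
by apply: stepFun_ext => k; rewrite !(sval_mul, sval_inv) opprD addrACA.
Qed.

Lemma stepFun_inv_continuous : continuous (fun z : G => z^-1)%g.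
Proof.
move=> x.
apply/(@metricType_numDomainType.cvgrPdist_lt R G G (nbhs x)) => e e0.
have := nbhsx_ballx x e e0; apply: filterS => y; rewrite ball_stepFun/=.
rewrite /mdist/= /step_dist -lenV; congr (len _ < e).
by apply: stepFun_ext => k; rewrite !(sval_mul, sval_inv) opprD.
Qed.

HB.instance Definition _ := isTopologicalGroup.Build G
  stepFun_mul_continuous stepFun_inv_continuous (@metric_hausdorff R G).

End StepFun.

(** * The strong Levy property of the group of step functions *)

Section Levy.
Variables (R : realType) (W : zmodType) (F : filtration W).
Local Notation G := (stepFun R F).
Implicit Types x y z : G.

(** A function of level [i] is determined by its restriction to one period,
    a map from a finite type to the finite set [F i]. *)
Lemma finite_level i : finite_set [set x : G | level F i (sval x)].
Proof.
have F0 : 0 \in F i by have [] := stage_zmod F i.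
pose h x := [ffun k : 'I_(2 ^ i) => insubd [` F0]%fset (sval x k)].
have h_inj : {in [set x : G | level F i (sval x)] &, injective h}.
  move=> x y /set_mem/= xi /set_mem/= yi /ffunP hxy; apply: stepFun_ext => k.
  rewrite -(level_mod _ xi) -(level_mod _ yi).
  have /(congr1 val) := hxy (Ordinal (ltn_pmod k (expn_gt0 2 i))).
  by rewrite !ffunE !val_insubd xi.2 yi.2.
by rewrite -(eq_finite_set (inj_card_eq h_inj)); exact: finite_finset.
Qed.

Definition level_group i : {fset G} := fset_set [set x : G | level F i (sval x)].

Lemma level_groupP i x : (x \in level_group i) <-> level F i (sval x).
Proof. by rewrite in_fset_set ?inE//; apply: finite_level. Qed.

(** The functions concentrated on one residue class modulo [2 ^ i]: one
    factor of the Hamming cube. *)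
Definition coord_set i j :=
  [set x : G | level F i (sval x) /\ forall k, (k %% 2 ^ i)%N != j -> sval x k = 0].

Definition coord_group i j : {fset G} := fset_set (coord_set i j).

Lemma coord_groupP i j x : (x \in coord_group i j) <-> coord_set i j x.
Proof.
rewrite in_fset_set ?inE//; apply: sub_finite_set (finite_level i).
by move=> y [].
Qed.

Lemma level_group_closed i : group_closed (mem (level_group i)).
Proof.
split=> [|x y]; first exact/level_groupP/level1.
move=> /level_groupP xi /level_groupP yi; apply/level_groupP.
by apply: levelM => //; apply: levelV.
Qed.

Lemma coord_group_closed i j : group_closed (mem (coord_group i j)).
Proof.
split=> [|x y]; first by apply/coord_groupP; split=> //; apply: level1.
move=> /coord_groupP[xi x0] /coord_groupP[yi y0]; apply/coord_groupP.
split=> [|k kj]; first by apply: levelM => //; apply: levelV.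
by rewrite sval_mul sval_inv x0// y0// subr0.
Qed.

Lemma coord_group_sub i j : (coord_group i j `<=` level_group i)%fset.
Proof. by apply/fsubsetP => x /coord_groupP[xi _]; apply/level_groupP. Qed.

Lemma coord_group_len i j x : x \in coord_group i j -> len x <= (2 ^ i)%:R^-1.
Proof.
move=> /coord_groupP[xi x0]; rewrite (lenE xi) -[leRHS]mul1r.
rewrite ler_wpM2r ?invr_ge0 ?ler0n// (ler_nat R _ 1).
have [ji|ij] := ltnP j (2 ^ i); last first.
  rewrite /nonzeros big1// => k _; rewrite x0 ?eqxx// modn_small//.
  by rewrite neq_ltn (leq_trans _ ij).
rewrite /nonzeros (bigD1 (Ordinal ji))//= big1 ?addn0 ?leq_b1// => k kj.
by rewrite x0 ?eqxx// modn_small.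
Qed.

Lemma level_cut i j f : level F i f ->
  level F i (fun k => if (k %% 2 ^ i == j)%N then f k else 0).
Proof.
move=> [pf vf]; split=> k; first by rewrite modnDr pf.
by case: ifP => // _; have [] := stage_zmod F i.
Qed.

Lemma level_group_decomp i x : x \in level_group i ->
  exists2 c : nat -> G, forall j, c j \in coord_group i j &
    x = (\prod_(j < 2 ^ i) c j)%g.
Proof.
move=> /level_groupP xi; exists (fun j => mkStep R (level_cut j xi)).
  move=> j; apply/coord_groupP; split=> [|k /= /negbTE ->//].
  exact: level_cut.
apply: stepFun_ext => k; rewrite sval_prod.
rewrite (bigD1 (Ordinal (ltn_pmod k (expn_gt0 2 i))))//= eqxx big1 ?addr0// => j.
by rewrite -val_eqE/= eq_sym => /negbTE ->.
Qed.

(** There are [2 ^ i] coordinates of length at most [1 / 2 ^ i], so the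
    variance bound is the sum of [2 ^ i] squares, that is [1 / 2 ^ i]. *)
Lemma level_group_concentration i (A B : {fset G}) (e : R) :
  (A `<=` level_group i)%fset -> (B `<=` level_group i)%fset -> 0 <= e <= 1 ->
  (forall x t, x \in B -> t \in A -> e <= len (x / t)%g) ->
  #|` A|%:R * (#|` B|%:R * e) ^+ 2 <= #|` level_group i|%:R ^+ 3 / (2 ^ i)%:R.
Proof.
move=> AK BK e01 far.
have := far_set_small (@stepFun_mulC R W F) (@len_ge0 R W F) (@len1 R W F)
  (@lenM R W F) (@level_group_closed i) (@coord_group_closed i)
  (@coord_group_sub i) (@level_group_decomp i) (@coord_group_len i) AK BK e01 far.
by rewrite -[_ ^+ 2 *+ _]mulr_natl expr2 mulVKf// pnatr_eq0 expn_eq0.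
Qed.

(** The previous estimate in terms of proportions, for any [U] that contains
    the [e]-neighbourhood of [A] in the level group. *)
Lemma level_group_ratio i (A U : set G) (e : R) : 0 <= e <= 1 ->
  (forall x t, x \in level_group i -> t \in level_group i -> A t ->
     len (x / t)%g < e -> U x) ->
  counting_prob R (level_group i) A *
    ((1 - counting_prob R (level_group i) U) * e) ^+ 2 <= (2 ^ i)%:R^-1.
Proof.
move=> e01 AU; set K := level_group i.
have k0 : 0 < #|` K|%:R :> R by apply: card_group_gt0; apply: level_group_closed.
have kN0 : #|` K|%:R != 0 :> R by rewrite gt_eqF.
set B := [fset x in K | x \notin U]%fset.
have -> : 1 - counting_prob R K U = #|` B|%:R / #|` K|%:R.
  rewrite /counting_prob -[X in X - _](divff kN0) -mulrBl; congr (_ / _).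
  apply/eqP; rewrite subr_eq -natrD eqr_nat addnC; apply/eqP.
  rewrite -(cardfsID [fset x in K | x \in U]%fset K); congr (_ + _)%N.
    by congr (#|` _|); apply/fsetP => x; rewrite !inE/= andbA andbb.
  congr (#|` _|); apply/fsetP => x; rewrite !inE/=.
  by case: (x \in K); rewrite ?andbT ?andbF.
have := @level_group_concentration i [fset x in K | x \in A]%fset B e.
have sub (P : pred G) : ([fset x in K | P x] `<=` K)%fset.
  by apply/fsubsetP => x; rewrite !inE/= => /andP[].
move=> /(_ (sub _) (sub _) e01) le.
rewrite /counting_prob -(ler_pM2l (exprn_gt0 3 k0)) (le_trans _ (le _))//.
  by rewrite le_eqVlt; apply/orP; left; apply/eqP; field.
move=> x t; rewrite !inE/= => /andP[xK /negP xU] /andP[tK tA].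
rewrite leNgt; apply/negP => xt; apply: xU; apply/mem_set.
by apply: AU xt => //; apply: set_mem.
Qed.

(** For a bounded sequence the lower limit is the supremum of the infima of
    its tails, so a positive lower limit makes one of these infima positive. *)
Lemma limn_inf_gt0 (u : nat -> R) : (forall i, 0 <= u i <= 1) ->
  0 < limn_inf u -> exists2 d, 0 < d & \forall i \near \oo, d <= u i.
Proof.
move=> u01; rewrite limn_infE; last first.
  exists 1; split=> // M M1 i _ /=; have /andP[u0 u1] := u01 i.
  by rewrite ger0_norm// (le_trans u1)// ltW.
move=> /sup_gt [|_ [N _ <-] d0].
  by exists (infs u 0); exists 0%N.
exists (infs u N) => //; exists N => // i Ni.
apply: ge_inf; last by exists i.
by exists 0 => _ [k _ <-]; have /andP[] := u01 k.
Qed.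

Lemma counting_prob01 (K : {fset G}) A : 0 <= counting_prob R K A <= 1.
Proof.
have [->|K0] := eqVneq K fset0.
  by rewrite /counting_prob cardfs0 invr0 mulr0 lexx ler01.
rewrite divr_ge0 ?ler0n//= ler_pdivrMr ?ltr0n ?cardfs_gt0// mul1r ler_nat.
by apply/fsubset_leq_card/fsubsetP => x; rewrite !inE/= => /andP[].
Qed.

Lemma stepFun_levy : strong_levy R G.
Proof.
exists level_group; split.
- exact: level_group_closed.
- move=> i; apply/fsubsetP => x /level_groupP xi; apply/level_groupP.
  exact: levelS.
- move=> U [x Ux] _; exists x; split=> //.
  by have [i xi] := levelP x; exists i => //=; apply/level_groupP.
move=> V A V1 AK /limn_inf_gt0[i|d d0 dA]; first exact: counting_prob01.
have [r r0 rV] : exists2 r : R, 0 < r & forall x, len x < r -> V x.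
  have /nbhs_ballP[r/= r0 rV] := open_nbhs_nbhs V1.
  by exists r => // x xr; apply: rV; rewrite ball_stepFun/= divg1.
(* The distance to a set is truncated at 1, hence the radius must be too. *)
pose e := Num.min r 1.
have e01 : 0 <= e <= 1 by rewrite le_min ltW//= ler01 ge_min lexx orbT.
have e0 : 0 < e by rewrite lt_min r0 ltr01.
apply/cvgrPdist_lt => eps eps0.
have q0 : 0 < d * (eps * e) ^+ 2 by rewrite mulr_gt0// exprn_gt0// mulr_gt0.
near=> i.
set U := [set (v * a)%g | v in V & a in A i].
have /andP[U0 U1] := counting_prob01 (level_group i) U.
rewrite ger0_norm ?subr_ge0// ltNge; apply/negP => far.
have : (2 ^ i)%:R^-1 < d * (eps * e) ^+ 2.
  by rewrite natrX -div1r; near: i; apply: (near_infty_natSinv_expn_lt (PosNum q0)).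
rewrite ltNge => /negP; apply.
apply: le_trans (@level_group_ratio i (A i) U e e01 _); last first.
  move=> x t xK tK At; rewrite lt_min => /andP[/rV xtV _].
  by exists (x / t)%g => //; exists t => //; rewrite divgK.
have epse : eps * e <= (1 - counting_prob R (level_group i) U) * e.
  by rewrite ler_pM2r.
have epse0 : 0 <= eps * e by rewrite mulr_ge0// ltW.
apply: ler_pM => //; [exact: ltW | exact: exprn_ge0 | by near: i |].
by apply: (lerXn2r _ _ _ epse); rewrite nnegrE ?(le_trans epse0 epse).
Unshelve. all: by end_near. Qed.

Lemma stepFun_separable : separable G.
Proof.
exists setT; split; last by move=> U [x Ux] _; exists x.
rewrite (_ : setT = \bigcup_i [set x : G | level F i (sval x)]); last first.
  by apply/seteqP; split=> // x _; have [i xi] := levelP x; exists i.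
by apply: bigcup_countable => // i _; apply/finite_set_countable/finite_level.
Qed.

End Levy.

(** * Step functions with values of prescribed torsion *)

Fixpoint prime_seq n : nat :=
  if n is m.+1 then s2val (prime_above (prime_seq m)) else 2.

Lemma prime_seq_prime n : prime (prime_seq n).
Proof. by case: n => [|n] //=; case: prime_above. Qed.

Lemma prime_seq_inj : injective prime_seq.
Proof.
have inc : {homo prime_seq : m n / (m < n)%N}.
  by apply: homo_ltn => [x y z|n /=]; [exact: ltn_trans|case: prime_above].
move=> m n mn; case: (ltngtP m n) => // /inc; by rewrite mn ltnn.
Qed.

(** The full product of the prime fields serves as a common ambient group;
    only its finitely supported elements enter the stages below. *)
Definition primeProd : Type := forall n, 'F_(prime_seq n).

HB.instance Definition _ := Choice.on primeProd.

Implicit Types (u v w : primeProd) (S : set nat).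

Definition pprod0 : primeProd := fun=> 0.
Definition pprodN u : primeProd := fun n => - u n.
Definition pprodD u v : primeProd := fun n => u n + v n.

Lemma pprodDA : associative pprodD.
Proof. by move=> u v w; apply: functional_extensionality_dep => n; apply: addrA. Qed.
Lemma pprodDC : commutative pprodD.
Proof. by move=> u v; apply: functional_extensionality_dep => n; apply: addrC. Qed.
Lemma pprod0D : left_id pprod0 pprodD.
Proof. by move=> u; apply: functional_extensionality_dep => n; apply: add0r. Qed.
Lemma pprodND : left_inverse pprod0 pprodN pprodD.
Proof. by move=> u; apply: functional_extensionality_dep => n; apply: addNr. Qed.

HB.instance Definition _ :=
  GRing.isZmodule.Build primeProd pprodDA pprodDC pprod0D pprodND.

Lemma pprod_mulrn u k n : (u *+ k) n = u n *+ k.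
Proof. by elim: k => // k IH; rewrite !mulrS -IH. Qed.

Definition supported S i : set primeProd :=
  [set u | forall n, u n != 0 -> (n < i)%N /\ S n].

(** An element supported below [i.+1] is one supported below [i] with its
    coordinate [i] overwritten by an arbitrary element of a prime field. *)
Lemma finite_supported S i : finite_set (supported S i).
Proof.
elim: i => [|i IH].
  apply: (@sub_finite_set _ _ [set 0]); last exact: finite_set1.
  move=> u u0; apply: functional_extensionality_dep => n; apply: contrapT.
  by move=> /eqP /u0[].
have fin : finite_set (supported S i `*` [set: 'F_(prime_seq i)]).
  by apply: finite_setX => //; exact: finite_finset.
apply: sub_finite_set (finite_image (fun uc => dfwith uc.1 i uc.2) fin).
move=> u ui; exists (dfwith u i 0, u i); last first.
  apply: functional_extensionality_dep => n /=.
  by have [<-|ni] := eqVneq i n; rewrite ?dfwithin// !dfwithout.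
split=> // n /=; have [<-|ni] := eqVneq i n; first by rewrite dfwithin eqxx.
rewrite dfwithout// => /ui[]; rewrite ltnS leq_eqVlt eq_sym.
by rewrite (negbTE ni).
Qed.

Definition supp_stage S i : {fset primeProd} := fset_set (supported S i).

Lemma supp_stageP S i u : (u \in supp_stage S i) <-> supported S i u.
Proof. by rewrite in_fset_set ?inE//; apply: finite_supported. Qed.

Lemma supp_stage_zmod S i : GRing.zmod_closed (mem (supp_stage S i)).
Proof.
split=> [|u v /supp_stageP uS /supp_stageP vS]; apply/supp_stageP => n.
  by rewrite eqxx.
rewrite (_ : (u - v) n = u n - v n)//.
have [->|/uS//] := eqVneq (u n) 0.
by have [->|/vS//] := eqVneq (v n) 0; rewrite subr0 eqxx.
Qed.

Lemma supp_stage_sub S i : (supp_stage S i `<=` supp_stage S i.+1)%fset.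
Proof.
apply/fsubsetP => u /supp_stageP uS; apply/supp_stageP => n /uS[ni Sn].
by rewrite ltnS (ltnW ni).
Qed.

Definition supp_filtration S : filtration primeProd :=
  Filtration (supp_stage_zmod S) (supp_stage_sub S).

(** If [n] is in [S], a constant function with value a nonzero vector of
    coordinate [n] is killed by the prime [p_n]. Conversely [p_n] kills no
    nonzero element of a prime field of another characteristic, so some
    nonzero value of [g] lives on coordinate [n], which forces [S n]. *)
Lemma supp_torsion (R : realType) S n :
  S n <-> exists g : stepFun R (supp_filtration S),
    g <> 1%g /\ (g ^+ prime_seq n = 1)%g.
Proof.
have charF m : prime_seq m \in [pchar 'F_(prime_seq m)].
  exact/pchar_Fp/prime_seq_prime.
split=> [Sn|[g [g1 gn]]].
  pose d : primeProd := dfwith (0 : primeProd) n 1.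
  have dS : level (supp_filtration S) n.+1 (fun=> d).
    split=> // _; apply/supp_stageP => m.
    have [<-|nm] := eqVneq n m; first by [].
    by rewrite /d dfwithout// eqxx.
  exists (mkStep R dS); split.
    move=> /(congr1 (fun g => sval g 0%N n)) /=; rewrite /d dfwithin.
    by move/eqP; rewrite oner_eq0.
  apply: stepFun_ext => k; rewrite sval_exp; apply: functional_extensionality_dep => m.
  rewrite pprod_mulrn /= /d; have [<-|nm] := eqVneq n m.
    by rewrite dfwithin mulrn_pchar.
  by rewrite dfwithout// mul0rn.
have [k [m gkm]] : exists k m, sval g k m != 0.
  apply: contrapT => g0; apply: g1; apply: stepFun_ext => k.
  apply: functional_extensionality_dep => m; apply: contrapT => /eqP gkm.
  by apply: g0; exists k, m.
have [i [_ /(_ k)/supp_stageP/(_ m gkm)[_ Sm]]] := levelP g.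
have : sval (g ^+ prime_seq n)%g k m = 0 by rewrite gn.
rewrite sval_exp pprod_mulrn => /eqP.
rewrite -mulr_natr mulf_eq0 (negbTE gkm)/= -(dvdn_pcharf (charF m)).
rewrite dvdn_prime2 ?prime_seq_prime// => /eqP/prime_seq_inj <-.
exact: Sm.
Qed.

(** * Topological isomorphisms *)

Lemma multiplicative_torsion (G H : groupType) (f : {multiplicative G -> H}) g n :
  injective f -> g <> 1%g -> (g ^+ n = 1)%g -> f g <> 1%g /\ (f g ^+ n = 1)%g.
Proof.
move=> f_inj g1 gn.
have f1 : f 1%g = 1%g by apply: (@mulgI _ (f 1%g)); rewrite -gmulfM !mulg1.
split; first by rewrite -f1 => /f_inj.
rewrite -f1 -gn; elim: n {gn} => [|n IH]; first by rewrite !expg0.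
by rewrite !expgS gmulfM IH.
Qed.

Lemma isomorphic_supp_sub (R : realType) S T :
  topgroup_isomorphic (stepFun R (supp_filtration S))
    (stepFun R (supp_filtration T)) -> S `<=` T.
Proof.
move=> [f [_ [h [fK _ _]]]] n /(supp_torsion R)[g [g1 gn]].
apply/(supp_torsion R); exists (f g).
by apply: multiplicative_torsion => //; apply: can_inj fK.
Qed.

Lemma topgroup_isomorphic_sym (G H : topologicalGroupType) :
  topgroup_isomorphic G H -> topgroup_isomorphic H G.
Proof.
move=> [f [fc [h [fK hK hc]]]].
have hM : {morph h : x y / (x * y)%g}.
  by move=> x y; rewrite -{1}(hK x) -{1}(hK y) -gmulfM fK.
pose hm := isMultiplicative.Build H G h hM.
pose h' : {multiplicative H -> G} := HB.pack h hm.
by exists h'; split=> //; exists f; split.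
Qed.

Lemma topgroup_isomorphic_refl (G : topologicalGroupType) :
  topgroup_isomorphic G G.
Proof.
by exists idfun; split=> [x|]; [exact: cvg_id|exists idfun; split=> // x; exact: cvg_id].
Qed.

(** * Coding countable sets of reals by sets of naturals *)

Section Code.
Variable R : realType.
Implicit Types (A : set R) (x y : nat -> R).

(** A choice depending on the set [A] only, so that sequences with the same
    range receive the same code. *)
Definition enumeration A : nat -> R := xget (fun=> 0) [set z | range z = A].

(** The lower Dedekind cuts of all terms of the enumeration, packed in one set
    of natural numbers. *)
Definition code A : set nat :=
  [set n | exists (m : nat) (r : rat),
     n = choice.pickle (m, r) /\ ratr r < enumeration A m].

Lemma range_enumeration x : range (enumeration (range x)) = range x.
Proof. by rewrite /enumeration; case: xgetP => [z _ /=|/(_ x)/=]. Qed.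

(** A rational between two terms in the wrong order would belong to the cut
    of the larger one only. *)
Lemma code_enumeration A B m : code A `<=` code B -> enumeration A m <= enumeration B m.
Proof.
move=> AB; rewrite leNgt; apply/negP => /rat_in_itvoo[r].
rewrite in_itv/= => /andP[Br rA].
have [|m' [r' [/(pcan_inj choice.pickleK)[<- <-]]]] := AB (choice.pickle (m, r)).
  by exists m, r.
by rewrite ltNge (ltW Br).
Qed.

Lemma code_inj x y : code (range x) = code (range y) -> range x = range y.
Proof.
move=> xy; have exy : enumeration (range x) = enumeration (range y).
  apply/funext => m; apply/le_anti/andP.
  by split; apply: code_enumeration; rewrite xy.
by rewrite -(range_enumeration x) exy range_enumeration.
Qed.

End Code.

Theorem corollary9p4 (R : realType) :
  exists G : (nat -> R) -> topologicalGroupType,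
    (forall x : nat -> R,
       separable (G x) /\ metrizable R (G x) /\ strong_levy R (G x)) /\
    (forall x y : nat -> R,
       eq_plus x y <-> topgroup_isomorphic (G x) (G y)).
Proof.
exists (fun x => stepFun R (supp_filtration (code (range x)))); split=> [x|x y].
  split; first exact: stepFun_separable.
  by split; [exact: stepFun_metrizable | exact: stepFun_levy].
split=> [->|iso]; first exact: topgroup_isomorphic_refl.
apply: code_inj; apply/seteqP; split; first exact: (isomorphic_supp_sub iso).
exact: (isomorphic_supp_sub (topgroup_isomorphic_sym iso)).
Qed.
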